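(* Let $\mathbf{k}$ be a local field of characteristic zero and let $n,D\geq 2$ be integers. Let $(f_m)_{m\in\mathbb{N}}$ be a sequence of elements of $\mathrm{Bir}(\mathbb{P}^n_{\mathbf{k}})$ such that $\mathrm{ord}(f_m)\leq D$ for all $m\gg 0$ and such that $(f_m)_m$ converges to $\mathrm{id}\in\mathrm{Bir}(\mathbb{P}^n_{\mathbf{k}})$ in the Euclidean topology. Then $f_m=\mathrm{id}$ for all $m\gg0$.
   Context: A local field is a field that is locally compact with respect to a non-discrete topology. $\mathrm{Bir}(\mathbb{P}^n_{\mathbf{k}})$ is the group of birational transformations of $\mathbb{P}^n_{\mathbf{k}}$ and $\mathrm{ord}(f)$ denotes the order of $f$ in this group. Euclidean topology: for $d\geq1$, let $W_d(\mathbf{k})$ be the projective space of equivalence classes $[h_0:\dots:h_n]$ of non-zero $(n+1)$-tuples of homogeneous polynomials of degree $d$ in $\mathbf{k}[x_0,\dots,x_n]$ modulo multiplication by $\lambda\in\mathbf{k}^*$; let $H_d(\mathbf{k})\subset W_d(\mathbf{k})$ be the subset of those $h$ for which the rational map $\psi_h\colon[x_0:\dots:x_n]\dashrightarrow[h_0(x):\dots:h_n(x)]$ is birational, and $\pi_d\colon H_d(\mathbf{k})\to\mathrm{Bir}(\mathbb{P}^n_{\mathbf{k}})$, $h\mapsto\psi_h$; its image is the set $\mathrm{Bir}(\mathbb{P}^n_{\mathbf{k}})_{\leq d}$ of maps of degree $\leq d$. Give $W_d(\mathbf{k})$ the topology induced by the topology of $\mathbf{k}$, $H_d(\mathbf{k})$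 the subspace topology, $\mathrm{Bir}(\mathbb{P}^n_{\mathbf{k}})_{\leq d}$ the quotient topology via $\pi_d$, and $\mathrm{Bir}(\mathbb{P}^n_{\mathbf{k}})$ the inductive limit topology of the inclusions $\mathrm{Bir}(\mathbb{P}^n_{\mathbf{k}})_{\leq d}\hookrightarrow\mathrm{Bir}(\mathbb{P}^n_{\mathbf{k}})_{\leq d+1}$ (a set is closed iff its intersection with every $\mathrm{Bir}(\mathbb{P}^n_{\mathbf{k}})_{\leq d}$ is closed there). *)

(* Defs.v *)
From HB Require Import structures.
From mathcomp Require Import all_boot all_order all_algebra.
From mathcomp Require Import mpoly.
From Stdlib Require List.

Set Implicit Arguments.
Unset Strict Implicit.
Unset Printing Implicit Defensive.

Import GRing.Theory.
Local Open Scope ring_scope.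

Section LocalField.
Variables (k : fieldType) (openk : (k -> Prop) -> Prop).

Definition is_topology : Prop :=
  [/\ openk (fun _ => True),
      (forall (I : Type) (F : I -> k -> Prop),
          (forall i, openk (F i)) -> openk (fun x => exists i, F i x)) &
      (forall U V, openk U -> openk V -> openk (fun x => U x /\ V x))].

Definition hausdorff : Prop :=
  forall x y : k, x <> y -> exists U V, [/\ openk U, openk V, U x, V y &
    forall z, U z -> V z -> False].

Definition add_continuous : Prop :=
  forall x y W, openk W -> W (x + y) ->
  exists U V, [/\ openk U, openk V, U x, V y &
    forall a b, U a -> V b -> W (a + b)].

Definition mul_continuous : Prop :=
  forall x y W, openk W -> W (x * y) ->
  exists U V, [/\ openk U, openk V, U x, V y &
    forall a b, U a -> V b -> W (a * b)].

Definition opp_continuous : Prop :=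
  forall x W, openk W -> W (- x) ->
  exists U, [/\ openk U, U x & forall a, U a -> W (- a)].

Definition inv_continuous : Prop :=
  forall x W, x != 0 -> openk W -> W (x^-1) ->
  exists U, [/\ openk U, U x & forall a, U a -> a != 0 -> W (a^-1)].

Definition topological_field : Prop :=
  [/\ is_topology /\ hausdorff, add_continuous, mul_continuous,
      opp_continuous & inv_continuous].

Definition non_discrete : Prop := exists U : k -> Prop, ~ openk U.

Definition compact (K : k -> Prop) : Prop :=
  forall (I : Type) (F : I -> k -> Prop), (forall i, openk (F i)) ->
  (forall x, K x -> exists i, F i x) ->
  exists s : seq I, forall x, K x -> exists i, List.In i s /\ F i x.

Definition locally_compact : Prop :=
  forall x : k, exists (U K : k -> Prop),
    [/\ openk U, U x, (forall y, U y -> K y) & compact K].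

Definition local_field : Prop :=
  [/\ topological_field, non_discrete & locally_compact].

End LocalField.

(* Birational maps of P^n_k, represented by (n+1)-tuples of homogeneous *)
(* polynomials in k[x_0,...,x_n].                                        *)
Section Bir.
Variables (k : fieldType) (openk : (k -> Prop) -> Prop) (n : nat).

Definition Tup := (n.+1).-tuple {mpoly k[n.+1]}.

Definition homtup (d : nat) (h : Tup) : Prop :=
  forall i, tnth h i \is d.-homog.

Definition nonzero_tup (h : Tup) : Prop := exists i, tnth h i != 0.

Definition Vd0 (d : nat) (h : Tup) : Prop := homtup d h /\ nonzero_tup h.

Definition idtup : Tup := [tuple 'X_i | i < n.+1].

Definition compt (g h : Tup) : Tup := [tuple (tnth g i) \mPo h | i < n.+1].

Definition scale_tup (c : k) (h : Tup) : Tup := [tuple c *: tnth h i | i < n.+1].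

(* h and h' define the same rational map *)
Definition ratequiv (h h' : Tup) : Prop :=
  forall i j, tnth h i * tnth h' j = tnth h j * tnth h' i.

Definition left_inverse_tup (g h : Tup) : Prop :=
  exists q : {mpoly k[n.+1]}, q != 0 /\ forall i, tnth (compt g h) i = q * 'X_i.

Definition birational_tup (h : Tup) : Prop :=
  exists (e : nat) (g : Tup),
    [/\ homtup e g, nonzero_tup g, left_inverse_tup g h & left_inverse_tup h g].

Definition Hd (d : nat) (h : Tup) : Prop := Vd0 d h /\ birational_tup h.

Definition is_bir (h : Tup) : Prop := exists d, (1 <= d)%N /\ Hd d h.

(* Topology on tuples induced by the topology of k through coefficients
   (on V_d this is the product topology of k^N). *)
Definition coef (j : 'I_n.+1 * 'X_{1..n.+1}) (h : Tup) : k :=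
  (tnth h j.1)@_(j.2).

Definition tup_open (U : Tup -> Prop) : Prop :=
  forall h, U h -> exists (s : seq ('I_n.+1 * 'X_{1..n.+1}))
                          (V : 'I_n.+1 * 'X_{1..n.+1} -> k -> Prop),
    [/\ forall j, List.In j s -> openk (V j),
        forall j, List.In j s -> V j (coef j h) &
        forall h', (forall j, List.In j s -> V j (coef j h')) -> U h'].

Definition tup_closed (C : Tup -> Prop) : Prop := tup_open (fun h => ~ C h).

Definition closed_in (A C : Tup -> Prop) : Prop :=
  exists C', tup_closed C' /\ forall h, A h -> (C h <-> C' h).

(* subsets of W_d(k) = (V_d \ {0}) / k^* are the k^*-saturated subsets *)
Definition saturated (d : nat) (C : Tup -> Prop) : Prop :=
  forall h c, Vd0 d h -> c != 0 -> (C h <-> C (scale_tup c h)).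

(* subsets of Bir(P^n_k): predicates compatible with equality of maps *)
Definition bir_set (S : Tup -> Prop) : Prop :=
  forall h h', is_bir h -> is_bir h' -> ratequiv h h' -> (S h <-> S h').

(* S is closed in Bir(P^n_k): for every d >= 1, S /\ Bir_{<=d} is closed for
   the quotient topology via pi_d, i.e. pi_d^{-1}(S) is closed in H_d(k),
   i.e. pi_d^{-1}(S) = H_d(k) /\ C with C closed in W_d(k) (C closed in
   W_d(k) = its preimage in V_d\{0} closed, W_d having the quotient
   topology). *)
Definition bir_closed (S : Tup -> Prop) : Prop :=
  forall d, (1 <= d)%N -> exists C : Tup -> Prop,
    [/\ saturated d C, closed_in (Vd0 d) C &
        forall h, Hd d h -> (S h <-> C h)].

Definition bir_open (U : Tup -> Prop) : Prop :=
  bir_set U /\ bir_closed (fun h => ~ U h).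

Definition bir_converges (f : nat -> Tup) (g : Tup) : Prop :=
  forall U, bir_open U -> U g -> exists N, forall m, (N <= m)%N -> U (f m).

Fixpoint tpow (f : Tup) (j : nat) : Tup :=
  if j is j'.+1 then compt f (tpow f j') else idtup.

Definition ord_le (f : Tup) (D : nat) : Prop :=
  exists j, (0 < j <= D)%N /\ ratequiv (tpow f j) idtup.

End Bir.

(* Main.v *)
Require Import Defs.
From HB Require Import structures.
From mathcomp Require Import all_boot all_order all_algebra.
From mathcomp Require Import mpoly.
From mathcomp Require Import ring.
From Stdlib Require Import Classical FunctionalExtensionality PropExtensionality.

(* It suffices that, in each degree, the set of non-trivial maps of order at most D
   is closed: its complement is then a neighbourhood of the identity.  Away from the
   representatives q x of the identity this is continuity of the iterates at a point.
   Near q x, take a point p with (x_0 q)(p) <> 0, let x be near p, and follow the orbit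
   y_0 = x, y_(l+1) = f(y_l) in the chart x_0 = const.  The increments
   v_l = y_(l+1) - y_l are values of a rational map with small coefficients, so by divided
   differences v_(l+1) - v_l is a combination of the coordinates of v_l with small
   coefficients, and so is v_l - v_0 in terms of v_0.  If f^j = id then
   v_0 + ... + v_(j-1) = 0, hence j v_0 = - sum (v_l - v_0) is a small linear image of
   v_0; since j <> 0 in k, a determinant close to 1 forces v_0 = 0, for all x in an open
   box.  As open sets are infinite, f = id.  No absolute value on k is needed:
   "small" means tending to zero along a filter. *)

Set Implicit Arguments.
Unset Strict Implicit.
Unset Printing Implicit Defensive.

Import GRing.Theory.
Local Open Scope ring_scope.

(** * Polynomials vanishing on a product of infinite sets *)

Section ZeroOnInfiniteBox.
Variable k : fieldType.

Definition infinite_set (U : k -> Prop) : Prop :=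
  forall s : seq k, exists2 x, U x & x \notin s.

Lemma infinite_roots_eq0 (U : k -> Prop) (p : {poly k}) :
  infinite_set U -> (forall x, U x -> p.[x] = 0) -> p = 0.
Proof.
move=> infU p0; apply/eqP/negP => /negP pn0.
have [s [us ss rs]] : exists s, [/\ uniq s, size s = size p & all (root p) s].
  elim: (size p) => [|m [s [us ss rs]]]; first by exists [::].
  have [x Ux xs] := infU s.
  by exists (x :: s); rewrite /= xs us ss rs andbT /root p0 ?eqxx.
by have := max_poly_roots pn0 rs us; rewrite ss ltnn.
Qed.

Variables (N : nat) (U : 'I_N -> k -> Prop).
Hypothesis infU : forall i, infinite_set (U i).

(* Coordinates are handled one at a time: the coordinates in [r] have been
   replaced by the extraction of the coefficient of exponent [m0]. *)
Lemma mpoly_zero_on_box_coef (p : {mpoly k[N]}) (m0 : 'X_{1..N}) (r : seq 'I_N) :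
  (forall x, (forall i, U i (x i)) -> p.@[x] = 0) -> uniq r ->
  forall x, (forall i, U i (x i)) ->
  \sum_(m <- msupp p | all (fun j => m j == m0 j) r)
     p@_m * \prod_(j | j \notin r) x j ^+ m j = 0.
Proof.
move=> p0; elim: r => [_ x Ux|i r IHr /= /andP[ir ur] x Ux].
  apply: etrans (p0 x Ux); by rewrite mevalE; apply: eq_big.
(* The sum for [r], read as a polynomial in the variable x_i alone: by induction it vanishes at
   every point of [U i], so its coefficient of degree [m0 i], which is the sum for [i :: r], is
   zero. *)
pose P : {poly k} := \sum_(m <- msupp p | all (fun j => m j == m0 j) r)
  (p@_m * \prod_(j | j \notin i :: r) x j ^+ m j) *: 'X^(m i).
have P0 : P = 0.
  apply: (infinite_roots_eq0 (infU i)) => a Ua.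
  pose xa j := if j == i then a else x j.
  have Uxa j : U j (xa j) by rewrite /xa; case: eqP => [->|].
  apply: etrans (IHr ur xa Uxa); rewrite horner_sum; apply: eq_bigr => m _.
  rewrite hornerZ hornerXn -mulrA; congr (_ * _).
  rewrite [RHS](bigD1 i) //= mulrC {1}/xa eqxx; congr (_ * _).
  apply: eq_big => [j|j jr]; first by rewrite inE negb_or andbC.
  by move: jr; rewrite /xa inE negb_or; case: eqP.
have := congr1 (fun q : {poly k} => q`_(m0 i)) P0.
rewrite coef0 coef_sum; apply: etrans.
rewrite big_mkcond [RHS]big_mkcond /=; apply: eq_bigr => m _.
rewrite coefZ coefXn eq_sym; case: eqP => /= [_|_]; case: all => //=.
  by rewrite mulr1.
by rewrite mulr0.
Qed.

Lemma mpoly_zero_on_box (p : {mpoly k[N]}) :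
  (forall x, (forall i, U i (x i)) -> p.@[x] = 0) -> p = 0.
Proof.
move=> p0; apply/mpolyP => m; rewrite mcoeff0.
have [x Ux] : exists x : 'I_N -> k, forall i, U i (x i).
  apply: (@fin_all_exists _ (fun=> k) (fun i a => U i a)) => i.
  by have [a Ua _] := infU i [::]; exists a.
(* Once every coordinate has been extracted, only the monomial [m] survives in the sum and the
   products are empty. *)
have := mpoly_zero_on_box_coef m p0 (enum_uniq 'I_N) Ux.
rewrite (eq_bigr (fun m' => p@_m')) => [|m' _]; last first.
  by rewrite big1 ?mulr1 // => j; rewrite mem_enum.
rewrite (eq_bigl (fun m' => m' == m)) => [|m']; last first.
  apply/allP/eqP => [mm'|-> //]; apply/mnmP => j.
  by apply/eqP/mm'; rewrite mem_enum.
have [mp|/memN_msupp_eq0 -> //] := boolP (m \in msupp p).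
by rewrite -big_filter filter_pred1_uniq ?msupp_uniq // big_seq1.
Qed.

End ZeroOnInfiniteBox.

(** * Substitution and iteration of homogeneous tuples *)

Section TupleAlgebra.
Variables (k : fieldType) (n : nat).
Local Notation P := {mpoly k[n.+1]}.
Implicit Types (p q : P) (g h F : Tup k n).

Lemma mpolyX_neq0 (m : 'X_{1..n.+1}) : 'X_[m] != 0 :> P.
Proof. by rewrite -msupp_eq0 msuppX. Qed.

(** Stated for [mmap] so as to cover both evaluation at points and substitution of tuples. *)
Lemma mmap_scale (S : comNzRingType) (phi : {rmorphism k -> S}) d (p : P)
  (c : S) (x y : 'I_n.+1 -> S) : p \is d.-homog ->
  (forall i, x i = c * y i) -> mmap phi x p = c ^+ d * mmap phi y p.
Proof.
move=> /dhomogP hp xy; rewrite /mmap big_distrr /= big_seq [RHS]big_seq.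
apply: eq_bigr => m /hp md; rewrite mulrCA; congr (_ * _).
rewrite /mmap1 -md /= mdegE -prodrXr -big_split /=.
by apply: eq_bigr => i _; rewrite xy exprMn.
Qed.

Lemma meval_scale d p c (x y : 'I_n.+1 -> k) : p \is d.-homog ->
  (forall i, x i = c * y i) -> p.@[x] = c ^+ d * p.@[y].
Proof. exact: mmap_scale. Qed.

Lemma comp_mpoly_scale d p c F F' : p \is d.-homog ->
  (forall i, tnth F i = c * tnth F' i) -> p \mPo F = c ^+ d * (p \mPo F').
Proof. exact: mmap_scale. Qed.

Lemma dhomog_comp d e p F : p \is d.-homog -> homtup e F ->
  p \mPo F \is (e * d).-homog.
Proof.
move=> /dhomogP hp hF; rewrite comp_mpolyE big_seq; apply: rpred_sum => m /hp md.
apply: dhomogZ; rewrite -md /= mdegE big_distrr /=.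
elim/big_rec2: _ => [|i a b _ ha]; first exact: dhomog1.
by apply: dhomogM => //; apply: dhomogMn.
Qed.

Lemma comp_mpolyA p F F' : p \mPo compt F F' = (p \mPo F) \mPo F'.
Proof.
rewrite [p \mPo F]comp_mpolyE raddf_sum /= comp_mpolyE; apply: eq_bigr => m _.
rewrite comp_mpolyZ rmorph_prod /=; congr (_ *: _); apply: eq_bigr => i _.
by rewrite rmorphXn /= tnth_mktuple.
Qed.

Lemma tpow_scale d h c : homtup d h -> c != 0 -> forall l,
  exists2 c', c' != 0 & tpow (scale_tup c h) l = scale_tup c' (tpow h l).
Proof.
move=> hh c0; elim=> [|l [c' c'0 IHl]] /=.
  exists 1; rewrite ?oner_eq0 //; apply: eq_from_tnth => i.
  by rewrite [RHS]tnth_mktuple scale1r.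
exists (c * c' ^+ d); first by rewrite mulf_neq0 ?expf_neq0.
apply: eq_from_tnth => i; rewrite !tnth_mktuple comp_mpolyZ IHl -scalerA.
congr (_ *: _); rewrite (@comp_mpoly_scale d _ c'%:MP _ (tpow h l)) //.
  by rewrite -rmorphXn mul_mpolyC.
by move=> j; rewrite tnth_mktuple mul_mpolyC.
Qed.

Lemma ratequiv_scaleL h h' c : c != 0 ->
  ratequiv (scale_tup c h) h' <-> ratequiv h h'.
Proof.
move=> c0; split=> E i j; have := E i j; rewrite !tnth_mktuple -!scalerAl.
  by move/(congr1 (fun p => c^-1 *: p)); rewrite !scalerA mulVf // !scale1r.
by move=> ->.
Qed.

Lemma ratequiv_sym h h' : ratequiv h h' -> ratequiv h' h.
Proof. by move=> E i j; rewrite mulrC E mulrC. Qed.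

(** The zero tuple is equivalent to every tuple, so the middle term has to have a non-zero
    coordinate, which is cancelled at the end. *)
Lemma ratequiv_trans h1 h2 h3 : nonzero_tup h2 ->
  ratequiv h1 h2 -> ratequiv h2 h3 -> ratequiv h1 h3.
Proof.
move=> [l h2l] E12 E23 i j; apply: (mulfI h2l).
have -> : tnth h2 l * (tnth h1 i * tnth h3 j)
  = tnth h1 i * tnth h2 l * tnth h3 j by ring.
rewrite E12 -mulrA E23.
have -> : tnth h2 l * (tnth h1 j * tnth h3 i)
  = tnth h1 j * tnth h2 l * tnth h3 i by ring.
rewrite [tnth h1 j * _]E12 -mulrA [tnth h2 j * _]E23; ring.
Qed.

(** Substituting the inverse [g] into p(h) gives p(q x) = q^d p, which is non-zero. *)
Lemma compt_nonzero_homog h : birational_tup h -> forall d p,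
  p \is d.-homog -> p != 0 -> p \mPo h != 0.
Proof.
move=> [e [g [_ _ _ [q [q0 hq]]]]] d p hp p0; apply/negP => /eqP ph.
have := comp_mpolyA p h g.
rewrite ph comp_mpoly0 (@comp_mpoly_scale d p q _ (idtup k n)) //; last first.
  by move=> i; rewrite hq tnth_mktuple.
by rewrite comp_mpoly_id => /eqP; rewrite mulf_eq0 expf_eq0 (negPf q0) andbF (negPf p0).
Qed.

Lemma tpow_nonzero_homog d h : homtup d h -> birational_tup h ->
  forall l e p, p \is e.-homog -> p != 0 -> p \mPo tpow h l != 0.
Proof.
move=> hh bh; elim=> [|l IHl] e p hp p0 /=; first by rewrite comp_mpoly_id.
rewrite comp_mpolyA; apply: (IHl (d * e)%N); first exact: dhomog_comp.
exact: compt_nonzero_homog hp p0.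
Qed.

Lemma tpow_nonzero d h : homtup d h -> birational_tup h ->
  forall l, nonzero_tup (tpow h l).
Proof.
move=> hh bh l; exists ord0.
have := @tpow_nonzero_homog d h hh bh l 1 'X_ord0; rewrite comp_mpolyXU -tnth_nth.
by apply; rewrite ?mpolyX_neq0 // dhomogX /= mdeg1.
Qed.

(** The iterates F and F' are proportional: F'_b F_j = F_b F'_j with F_b and F'_b non-zero.
    Homogeneity of [h] gives F'_b^d h(F) = F_b^d h(F'), so h(F) is equivalent to h(F'), and h(F') to
    h'(F') by substitution in the relations between [h] and [h']. *)
Lemma ratequiv_tpow d d' h h' : homtup d h -> homtup d' h' ->
  birational_tup h -> birational_tup h' -> ratequiv h h' ->
  forall l, ratequiv (tpow h l) (tpow h' l).
Proof.
move=> hh hh' bh bh' hE; elim=> [|l IHl] /=; first by move=> i j; rewrite mulrC.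
have [a Fa] := tpow_nonzero hh bh l; have [b Fb] := tpow_nonzero hh' bh' l.
set F := tpow h l in IHl Fa *; set F' := tpow h' l in IHl Fb *.
have Fb0 : tnth F b != 0.
  apply: contraNneq (mulf_neq0 Fa Fb) => Fb0.
  by rewrite IHl Fb0 mul0r.
have hF : nonzero_tup (compt h F).
  exact: (tpow_nonzero hh bh l.+1).
have E i : tnth F' b ^+ d * tnth (compt h F) i = tnth F b ^+ d * tnth (compt h F') i.
  rewrite !tnth_mktuple; pose F'' : Tup k n := [tuple tnth F' b * tnth F j | j < n.+1].
  rewrite -(@comp_mpoly_scale d _ (tnth F' b) F'') //; last first.
    by move=> j; rewrite tnth_mktuple.
  rewrite -(@comp_mpoly_scale d _ (tnth F b) F'') //.
  by move=> j; rewrite tnth_mktuple mulrC IHl.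
apply: (@ratequiv_trans _ (compt h F')).
- have [i hFi] := hF; exists i.
  have : tnth F' b ^+ d * tnth (compt h F) i != 0 by rewrite mulf_neq0 ?expf_neq0.
  by rewrite E mulf_eq0 => /norP[].
- move=> i j; apply: (mulfI (expf_neq0 d Fb)); rewrite !mulrA !E.
  by rewrite -!mulrA; congr (_ * _); rewrite mulrC.
move=> i j; rewrite !tnth_mktuple -!rmorphM /=; congr (_ \mPo _); exact: hE.
Qed.

Lemma ratequiv_tpow_id h h' l : is_bir h -> is_bir h' -> ratequiv h h' ->
  ratequiv (tpow h l) (idtup k n) -> ratequiv (tpow h' l) (idtup k n).
Proof.
move=> [d [_ [[hh _] bh]]] [d' [_ [[hh' _] bh']]] hE.
apply: ratequiv_trans; first exact: tpow_nonzero hh bh l.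
by apply: ratequiv_sym; apply: (ratequiv_tpow hh hh').
Qed.

End TupleAlgebra.

(** * Limits along a filter in a topological field *)

Record is_filter (T : Type) (G : (T -> Prop) -> Prop) : Prop := IsFilter {
  filterT : G (fun _ => True);
  filterI : forall A B, G A -> G B -> G (fun t => A t /\ B t);
  filterS : forall A B : T -> Prop, (forall t, A t -> B t) -> G A -> G B }.

Section Convergence.
Variables (k : fieldType) (openk : (k -> Prop) -> Prop).
Hypothesis topk : topological_field openk.
Variables (T : Type) (G : (T -> Prop) -> Prop).
Hypothesis filG : is_filter G.

Lemma filter_always (A : T -> Prop) : (forall t, A t) -> G A.
Proof. by move=> At; apply: (filterS filG) (filterT filG). Qed.

Lemma filter_forall (I : finType) (A : I -> T -> Prop) :
  (forall i, G (A i)) -> G (fun t => forall i, A i t).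
Proof.
move=> GA; suff: G (fun t => forall i, i \in enum I -> A i t).
  by apply: (filterS filG) => t At i; apply: At; rewrite mem_enum.
elim: (enum I) => [|i s IHs]; first exact: filter_always.
apply: (filterS filG) (filterI filG (GA i) IHs) => t [Ai As] j.
by rewrite inE => /orP[/eqP->|/As].
Qed.

Definition cvg (c : T -> k) (a : k) : Prop :=
  forall W, openk W -> W a -> G (fun t => W (c t)).

Lemma cvg_near c c' a : G (fun t => c t = c' t) -> cvg c a -> cvg c' a.
Proof.
move=> cc' ca W oW Wa; apply: (filterS filG) (filterI filG cc' (ca W oW Wa)).
by move=> t [->].
Qed.

Lemma cvg_ext c c' a : (forall t, c t = c' t) -> cvg c a -> cvg c' a.
Proof. by move=> cc'; apply: cvg_near; apply: filter_always. Qed.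

Lemma cvg_cst a : cvg (fun=> a) a.
Proof. by move=> W _ Wa; apply: filter_always. Qed.

Lemma cvgD c c' a a' : cvg c a -> cvg c' a' -> cvg (fun t => c t + c' t) (a + a').
Proof.
move=> ca ca' W oW Wa; have [_ addC _ _ _] := topk.
have [U [V [oU oV Ua Va UV]]] := addC _ _ _ oW Wa.
apply: (filterS filG) (filterI filG (ca U oU Ua) (ca' V oV Va)) => t [].
exact: UV.
Qed.

Lemma cvgM c c' a a' : cvg c a -> cvg c' a' -> cvg (fun t => c t * c' t) (a * a').
Proof.
move=> ca ca' W oW Wa; have [_ _ mulC _ _] := topk.
have [U [V [oU oV Ua Va UV]]] := mulC _ _ _ oW Wa.
apply: (filterS filG) (filterI filG (ca U oU Ua) (ca' V oV Va)) => t [].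
exact: UV.
Qed.

Lemma cvgN c a : cvg c a -> cvg (fun t => - c t) (- a).
Proof.
move=> ca W oW Wa; have [_ _ _ oppC _] := topk.
have [U [oU Ua UW]] := oppC _ _ oW Wa.
by apply: (filterS filG) (ca U oU Ua) => t; apply: UW.
Qed.

Lemma cvgB c c' a a' : cvg c a -> cvg c' a' -> cvg (fun t => c t - c' t) (a - a').
Proof. by move=> ca ca'; apply: cvgD ca (cvgN ca'). Qed.

Lemma cvg_neq0 c a : cvg c a -> a != 0 -> G (fun t => c t != 0).
Proof.
move=> ca /eqP a0; have [[_ sepk] _ _ _ _] := topk.
have [U [V [oU oV Ua V0 UV]]] := sepk _ _ a0.
apply: (filterS filG) (ca U oU Ua) => t Uc; apply/eqP => c0.
by apply: (UV (c t)) => //; rewrite c0.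
Qed.

Lemma cvgV c a : cvg c a -> a != 0 -> cvg (fun t => (c t)^-1) a^-1.
Proof.
move=> ca a0 W oW Wa; have [_ _ _ _ invC] := topk.
have [U [oU Ua UW]] := invC _ _ a0 oW Wa.
apply: (filterS filG) (filterI filG (ca U oU Ua) (cvg_neq0 ca a0)) => t [].
exact: UW.
Qed.

Lemma cvg_sum (I : Type) (r : seq I) (Q : pred I) (F : I -> T -> k) (a : I -> k) :
  (forall i, Q i -> cvg (F i) (a i)) ->
  cvg (fun t => \sum_(i <- r | Q i) F i t) (\sum_(i <- r | Q i) a i).
Proof.
move=> Fa; elim: r => [|i r IHr].
  by rewrite big_nil; apply: (cvg_ext _ (@cvg_cst 0)) => t; rewrite big_nil.
rewrite big_cons; case: ifP => Qi; last first.
  by apply: (cvg_ext _ IHr) => t; rewrite big_cons Qi.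
by apply: (cvg_ext _ (cvgD (Fa i Qi) IHr)) => t; rewrite big_cons Qi.
Qed.

Lemma cvg_prod (I : Type) (r : seq I) (Q : pred I) (F : I -> T -> k) (a : I -> k) :
  (forall i, Q i -> cvg (F i) (a i)) ->
  cvg (fun t => \prod_(i <- r | Q i) F i t) (\prod_(i <- r | Q i) a i).
Proof.
move=> Fa; elim: r => [|i r IHr].
  by rewrite big_nil; apply: (cvg_ext _ (@cvg_cst 1)) => t; rewrite big_nil.
rewrite big_cons; case: ifP => Qi; last first.
  by apply: (cvg_ext _ IHr) => t; rewrite big_cons Qi.
by apply: (cvg_ext _ (cvgM (Fa i Qi) IHr)) => t; rewrite big_cons Qi.
Qed.

Lemma cvgX c a e : cvg c a -> cvg (fun t => c t ^+ e) (a ^+ e).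
Proof.
move=> ca; have := @cvg_prod _ (index_iota 0 e) xpredT (fun=> c) (fun=> a) (fun _ _ => ca).
by rewrite prodr_const_nat subn0; apply: cvg_ext => t; rewrite prodr_const_nat subn0.
Qed.

Lemma cvg_det N (M : T -> 'M[k]_N) (A : 'M[k]_N) :
  (forall i j, cvg (fun t => M t i j) (A i j)) -> cvg (fun t => \det (M t)) (\det A).
Proof.
move=> MA; apply: cvg_sum => s _; apply: cvgM; first exact: cvg_cst.
by apply: cvg_prod => i _.
Qed.

Section PolynomialFamilies.
Variable N : nat.
Implicit Types (P Q : T -> {mpoly k[N]}) (p q : {mpoly k[N]}).

Definition mcvg P p : Prop := forall m, cvg (fun t => (P t)@_m) p@_m.

Lemma mcvg_cst p : mcvg (fun=> p) p.
Proof. by move=> m; apply: cvg_cst. Qed.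

Lemma mcvgB P p Q q : mcvg P p -> mcvg Q q -> mcvg (fun t => P t - Q t) (p - q).
Proof.
move=> Pp Qq m; rewrite mcoeffB.
by apply: (cvg_ext _ (cvgB (Pp m) (Qq m))) => t; rewrite mcoeffB.
Qed.

Lemma mcvgM P p Q q : mcvg P p -> mcvg Q q -> mcvg (fun t => P t * Q t) (p * q).
Proof.
move=> Pp Qq m; rewrite mcoeffM.
have -> : (fun t => (P t * Q t)@_m) = (fun t =>
    \sum_(l : 'X_{1..N < (mdeg m).+1, (mdeg m).+1} | m == (l.1 + l.2)%MM)
       (P t)@_l.1 * (Q t)@_l.2).
  by apply: functional_extensionality => t; rewrite mcoeffM.
by apply: cvg_sum => i _; apply: cvgM.
Qed.

(** Coefficientwise convergence leaves the degrees free; the eventual bound [w] turns evaluation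
    into a sum over a fixed finite set of monomials. *)
Lemma cvg_meval w P p (y : 'I_N -> T -> k) (a : 'I_N -> k) :
  mcvg P p -> G (fun t => msize (P t) <= w)%N -> (forall i, cvg (y i) (a i)) ->
  cvg (fun t => (P t).@[y^~ t]) p.@[a].
Proof.
move=> Pp Pw ya; set w' := maxn w (msize p).
rewrite /meval (mmapE w') ?leq_maxr //.
apply: (@cvg_near (fun t => \sum_(m : 'X_{1..N < w'}) (P t)@_m * mmap1 (y^~ t) m)).
  apply: (filterS filG) Pw => t Pw; rewrite /meval (mmapE w') //.
  exact: leq_trans Pw (leq_maxl _ _).
apply: cvg_sum => m _; apply: cvgM; first exact: Pp.
by apply: cvg_prod => i _; apply: cvgX.
Qed.

End PolynomialFamilies.

(* [tame false] is the ring of functions having a limit, [tame true] its ideal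
   of functions tending to zero. *)
Definition tame (b : bool) (c : T -> k) : Prop :=
  if b then cvg c 0 else exists a, cvg c a.

Lemma tame_conv b c : tame b c -> tame false c.
Proof. by case: b => // c0; exists 0. Qed.

Lemma tame0 b : tame b (fun=> 0).
Proof. by case: b => /=; [|exists 0]; apply: cvg_cst. Qed.

Lemma tameD b c c' : tame b c -> tame b c' -> tame b (fun t => c t + c' t).
Proof.
case: b => /= [c0 c0'|[a ca] [a' ca']]; last by exists (a + a'); apply: cvgD.
by rewrite -[0]addr0; apply: cvgD.
Qed.

Lemma tameM b c c' : tame b c -> tame false c' -> tame b (fun t => c t * c' t).
Proof.
case: b => /= [c0 [a ca]|[a ca] [a' ca']]; last by exists (a * a'); apply: cvgM.
by rewrite -[0](mul0r a); apply: cvgM.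
Qed.

(** * Modules over the ring of convergent functions *)

Section Span.
Variables (N : nat) (v : 'I_N -> T -> k).

(** For germs along [G]: if [b] is false, the module spanned by [v] over the functions having a
    limit; if [b] is true, its product with the ideal of functions tending to zero. *)
Definition lspan (b : bool) (u : T -> k) : Prop :=
  exists2 delta : 'I_N -> T -> k, (forall m, tame b (delta m)) &
    G (fun t => u t = \sum_m delta m t * v m t).

Lemma lspan_near b u u' : G (fun t => u t = u' t) -> lspan b u -> lspan b u'.
Proof.
move=> uu' [delta tdelta ud]; exists delta => //.
by apply: (filterS filG) (filterI filG uu' ud) => t [->].
Qed.

Lemma lspan_ext b u u' : (forall t, u t = u' t) -> lspan b u -> lspan b u'.
Proof. by move=> uu'; apply: lspan_near; apply: filter_always. Qed.

Lemma lspan_conv b u : lspan b u -> lspan false u.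
Proof. by move=> [delta td ud]; exists delta => // m; apply: tame_conv (td m). Qed.

Lemma lspan0 b : lspan b (fun=> 0).
Proof.
exists (fun _ _ => 0) => [m|]; first exact: tame0.
by apply: filter_always => t; rewrite big1 // => m _; rewrite mul0r.
Qed.

Lemma lspan_gen i : lspan false (v i).
Proof.
exists (fun m _ => (m == i)%:R) => [m|]; first by exists (m == i)%:R; apply: cvg_cst.
apply: filter_always => t; rewrite (bigD1 i) //= eqxx mul1r big1 ?addr0 // => m.
by move/negPf->; rewrite mul0r.
Qed.

Lemma lspanD b u u' : lspan b u -> lspan b u' -> lspan b (fun t => u t + u' t).
Proof.
move=> [delta td ud] [delta' td' ud'].
exists (fun m t => delta m t + delta' m t) => [m|]; first exact: tameD.
apply: (filterS filG) (filterI filG ud ud') => t [-> ->].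
by rewrite -big_split /=; apply: eq_bigr => m _; rewrite mulrDl.
Qed.

Lemma lspanM b b' c u : (forall d, tame b d -> tame b' (fun t => c t * d t)) ->
  lspan b u -> lspan b' (fun t => c t * u t).
Proof.
move=> cM [delta td ud]; exists (fun m t => c t * delta m t) => [m|].
  exact: cM.
apply: (filterS filG) ud => t ->; rewrite big_distrr /=.
by apply: eq_bigr => m _; rewrite mulrA.
Qed.

Lemma lspanMl b c u : tame b c -> lspan false u -> lspan b (fun t => c t * u t).
Proof. by move=> tc; apply: lspanM => d; apply: tameM. Qed.

Lemma lspanMr b c u : tame false c -> lspan b u -> lspan b (fun t => u t * c t).
Proof.
move=> tc su; apply: (@lspan_ext _ (fun t => c t * u t)) => [t|]; first exact: mulrC.
apply: (lspanM _ su) => d td; have := tameM td tc.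
case: b {su td} => [|[a da]]; last first.
  by exists a; apply: (cvg_ext _ da) => t; rewrite mulrC.
by apply: cvg_ext => t; rewrite mulrC.
Qed.

Lemma lspanB b u u' : lspan b u -> lspan b u' -> lspan b (fun t => u t - u' t).
Proof.
move=> su su'; apply: lspanD su _.
apply: (@lspan_ext _ (fun t => u' t * -1)) => [t|]; first by rewrite mulrN1.
by apply: lspanMr su'; exists (-1); apply: cvg_cst.
Qed.

Lemma lspan_sum b (I : Type) (r : seq I) (u : I -> T -> k) :
  (forall i, lspan b (u i)) -> lspan b (fun t => \sum_(i <- r) u i t).
Proof.
move=> su; elim: r => [|i r IHr].
  by apply: lspan_ext (lspan0 b) => t; rewrite big_nil.
by apply: lspan_ext (lspanD (su i) IHr) => t; rewrite big_cons.
Qed.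

(** Limits are part of the relation because compatibility with products rests on u w - u' w' = u (w
    - w') + w' (u - u'). *)
Definition congruent (u u' : T -> k) : Prop :=
  [/\ tame false u, tame false u' & lspan false (fun t => u t - u' t)].

Lemma congruent_cst a : congruent (fun=> a) (fun=> a).
Proof.
split; try by exists a; apply: cvg_cst.
by apply: lspan_ext (lspan0 false) => t; rewrite subrr.
Qed.

Lemma congruentM u u' w w' : congruent u u' -> congruent w w' ->
  congruent (fun t => u t * w t) (fun t => u' t * w' t).
Proof.
move=> [tu tu' su] [tw tw' sw]; split; try exact: tameM.
apply: lspan_ext (lspanD (lspanMl tu sw) (lspanMl tw' su)) => t; ring.
Qed.

Lemma congruent_prod (I : Type) (r : seq I) (X Y : I -> T -> k) :
  (forall i, congruent (X i) (Y i)) ->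
  congruent (fun t => \prod_(i <- r) X i t) (fun t => \prod_(i <- r) Y i t).
Proof.
move=> XY; elim: r => [|i r IHr].
  have -> : (fun t => \prod_(i <- [::]) X i t) = (fun=> 1).
    by apply: functional_extensionality => t; rewrite big_nil.
  have -> : (fun t => \prod_(i <- [::]) Y i t) = (fun=> 1).
    by apply: functional_extensionality => t; rewrite big_nil.
  exact: congruent_cst.
have -> : (fun t => \prod_(j <- i :: r) X j t) = (fun t => X i t * \prod_(j <- r) X j t).
  by apply: functional_extensionality => t; rewrite big_cons.
have -> : (fun t => \prod_(j <- i :: r) Y j t) = (fun t => Y i t * \prod_(j <- r) Y j t).
  by apply: functional_extensionality => t; rewrite big_cons.
exact: congruentM.
Qed.

Lemma congruentX u u' e : congruent u u' ->
  congruent (fun t => u t ^+ e) (fun t => u' t ^+ e).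
Proof.
move=> uu'; elim: e => [|e IHe]; first exact: congruent_cst.
have -> : (fun t => u t ^+ e.+1) = (fun t => u t * u t ^+ e).
  by apply: functional_extensionality => t; rewrite exprS.
have -> : (fun t => u' t ^+ e.+1) = (fun t => u' t * u' t ^+ e).
  by apply: functional_extensionality => t; rewrite exprS.
exact: congruentM.
Qed.

(** This replaces divided differences: congruent arguments give congruent monomials, and the
    coefficients of [P] act as scalars, from the ideal when [b] is true. *)
Lemma lspan_meval b w n' (P : T -> {mpoly k[n']}) (X Y : 'I_n' -> T -> k) :
  (forall m, tame b (fun t => (P t)@_m)) -> G (fun t => msize (P t) <= w)%N ->
  (forall i, congruent (X i) (Y i)) ->
  lspan b (fun t => (P t).@[X^~ t] - (P t).@[Y^~ t]).
Proof.
move=> tP Pw XY.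
apply: (@lspan_near _ (fun t => \sum_(m : 'X_{1..n' < w}) (P t)@_m *
   (\prod_i X i t ^+ m i - \prod_i Y i t ^+ m i))).
  apply: (filterS filG) Pw => t Pw; rewrite /meval !(mmapE w) // -sumrB.
  by apply: eq_bigr => m _; rewrite mulrBr.
apply: lspan_sum => m; apply: lspanMl => //.
by have [_ _] := congruent_prod (index_enum 'I_n') (fun i => congruentX (m i) (XY i)).
Qed.

(* Nakayama's lemma for the module spanned by [v]. *)
Lemma lspan_true_eq0 : (forall i, lspan true (v i)) -> G (fun t => forall i, v i t = 0).
Proof.
move=> sv; have [delta dP] : exists delta : 'I_N -> 'I_N -> T -> k, forall i,
    (forall m, cvg (delta i m) 0) /\ G (fun t => v i t = \sum_m delta i m t * v m t).
  apply: (@fin_all_exists _ (fun=> 'I_N -> T -> k) (fun i d =>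
    (forall m, cvg (d m) 0) /\ G (fun t => v i t = \sum_m d m t * v m t))) => i.
  by have [d td vd] := sv i; exists d.
(* The relations read (1 - delta) v = 0, and the determinant of 1 - delta tends to 1, so this matrix
   is eventually invertible. *)
pose M t : 'M[k]_N := 1%:M - \matrix_(i, m) delta i m t.
have cM : cvg (fun t => \det (M t)) (\det (1%:M : 'M[k]_N)).
  apply: cvg_det => i j; apply: (@cvg_ext (fun t => (i == j)%:R - delta i j t)).
    by move=> t; rewrite !mxE.
  rewrite mxE -[X in cvg _ X]subr0; apply: cvgB; first exact: cvg_cst.
  by have [d0 _] := dP i.
rewrite det1 in cM.
apply: (filterS filG) (filterI filG (cvg_neq0 cM (oner_neq0 k))
  (filter_forall (fun i => (dP i).2))).
move=> t [detM vE]; have Mu : M t \in unitmx by rewrite unitmxE unitfE.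
have Mv : M t *m \col_i v i t = 0.
  rewrite mulmxBl mul1mx; apply/colP => i; rewrite !mxE vE; apply/eqP.
  by rewrite subr_eq0; apply/eqP/eq_bigr => m _; rewrite !mxE.
move=> i; have := congr1 (mulmx (invmx (M t))) Mv; rewrite mulKmx // mulmx0.
by move/colP/(_ i); rewrite !mxE.
Qed.

End Span.
End Convergence.

(** * Open sets of a non-discrete topological field *)

Section FieldTopology.
Variables (k : fieldType) (openk : (k -> Prop) -> Prop).
Hypothesis topk : topological_field openk.

Lemma open_locally (A : k -> Prop) :
  (forall x, A x -> exists U, [/\ openk U, U x & forall y, U y -> A y]) -> openk A.
Proof.
move=> Aloc; have [[[_ cupO _] _] _ _ _ _] := topk.
pose I := {U : k -> Prop | openk U /\ forall y, U y -> A y}.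
(* [openk] is not assumed invariant under pointwise equivalence, so [A] must be equal to the
   union. *)
suff -> : A = (fun x => exists i : I, sval i x).
  by apply: cupO => -[U []].
apply: functional_extensionality => x; apply: propositional_extensionality.
split=> [/Aloc [U [oU Ux UA]]|[[U [oU UA]] /UA //]].
by exists (exist _ U (conj oU UA)).
Qed.

(** If [U] lay inside a finite list, Hausdorff separation would give an open [W] with [U] and [W]
    meeting only in [p]; by translation every point, hence every set, would be open. *)
Lemma open_infinite (U : k -> Prop) p :
  non_discrete openk -> openk U -> U p -> infinite_set U.
Proof.
move=> [A nA] oU Up s; apply: NNPP => Us; apply: nA.
have [[[openT _ openI] sepk] addC _ _ _] := topk.
have [W [oW Wp Wfin]] : exists W, [/\ openk W, W p & forall x, W x -> x \in s -> x = p].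
  elim: s {Us} => [|a s [W [oW Wp Wfin]]]; first by exists (fun=> True).
  have [->|/eqP/nesym ap] := eqVneq a p.
    by exists W; split=> // x Wx; rewrite inE => /orP[/eqP|/Wfin]; last exact.
  have [V [V' [oV oV' Vp Va VV']]] := sepk _ _ ap.
  exists (fun x => W x /\ V x); split=> //; first exact: openI.
  move=> x [Wx Vx]; rewrite inE => /orP[/eqP xa|]; last exact: Wfin.
  by case: (VV' x Vx); rewrite xa.
apply: open_locally => x Ax.
have oUW := openI _ _ oU oW.
have UWp : U (x + (p - x)) /\ W (x + (p - x)) by rewrite addrC subrK.
have [V [V' [oV oV' Vx V'x VV']]] := addC _ _ _ oUW UWp.
exists V; split=> // y Vy; have [Uy Wy] := VV' _ _ Vy V'x.
suff -> : y = x by [].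
have ys : y + (p - x) \in s.
  by apply: NNPP => ys; apply: Us; exists (y + (p - x)) => //; apply/negP.
by have := Wfin _ Wy ys; rewrite addrCA -[RHS]addr0 => /addrI/eqP; rewrite subr_eq0 => /eqP.
Qed.

End FieldTopology.

Lemma msize_dhomog (k : fieldType) N d (p : {mpoly k[N]}) :
  p \is d.-homog -> (msize p <= d.+1)%N.
Proof. by move/dhomogP=> hp; rewrite msizeE; apply/bigmax_leqP_seq => m /hp ->. Qed.

(** * Torsion maps near a representative of the identity *)

Section NearIdentity.
Variables (k : fieldType) (openk : (k -> Prop) -> Prop) (n : nat).
Hypothesis topk : topological_field openk.
Variables (T : Type) (G : (T -> Prop) -> Prop).
Hypothesis filG : is_filter G.
Variables (d : nat) (H : T -> Tup k n) (h0 : Tup k n).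
Hypothesis H_cvg : forall i, mcvg openk G (fun t => tnth (H t) i) (tnth h0 i).
Hypothesis H_homog : G (fun t => homtup d (H t)).

Lemma cvg_eval_tup (y : 'I_n.+1 -> T -> k) a i : (forall j, cvg openk G (y j) (a j)) ->
  cvg openk G (fun t => (tnth (H t) i).@[y^~ t]) (tnth h0 i).@[a].
Proof.
apply: (@cvg_meval _ _ topk _ _ filG _ d.+1) => //.
by apply: (filterS filG) H_homog => t Ht; apply: msize_dhomog.
Qed.

Lemma cvg_eval_tpow (z : 'I_n.+1 -> k) l i :
  cvg openk G (fun t => (tnth (tpow (H t) l) i).@[z]) (tnth (tpow h0 l) i).@[z].
Proof.
elim: l i => [|l IHl] i; first exact: (cvg_cst filG).
rewrite [tpow h0 l.+1]/= tnth_mktuple comp_mpoly_meval.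
apply: (cvg_ext filG _ (@cvg_eval_tup _ _ i IHl)) => t.
by rewrite [tpow _ _.+1]/= tnth_mktuple comp_mpoly_meval.
Qed.

(** Numerator of the displacement in the chart; if it vanishes for all [i], then [h] is proportional
    to the coordinate tuple. *)
Definition defect (h : Tup k n) (i : 'I_n.+1) : {mpoly k[n.+1]} :=
  'X_ord0 * tnth h i - 'X_i * tnth h ord0.

(* The map in the chart x_0 = const, in which it is y |-> y + defect(y)/h_0(y). *)
Fixpoint orbit (h : Tup k n) (x : 'I_n.+1 -> k) (l : nat) : 'I_n.+1 -> k :=
  if l is l'.+1 then
    fun i => orbit h x l' ord0 * (tnth h i).@[orbit h x l']
               / (tnth h ord0).@[orbit h x l']
  else x.

Lemma orbit0 h x l : (forall l', (l' < l)%N -> (tnth h ord0).@[orbit h x l'] != 0) ->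
  orbit h x l ord0 = x ord0.
Proof.
elim: l => [|l IHl] //= h_neq0; rewrite mulfK ?h_neq0 //.
by apply: IHl => l' ll'; apply: h_neq0; apply: ltnW.
Qed.

Lemma orbit_tpow h x l : homtup d h -> x ord0 != 0 ->
  (forall l', (l' < l)%N -> (tnth h ord0).@[orbit h x l'] != 0) ->
  exists2 c, c != 0 & forall i, (tnth (tpow h l) i).@[x] = c * orbit h x l i.
Proof.
move=> hh x0; elim: l => [|l IHl] h_neq0.
  by exists 1; rewrite ?oner_neq0 // => i; rewrite tnth_mktuple mevalXU mul1r.
have h_neq0' l' : (l' < l)%N -> (tnth h ord0).@[orbit h x l'] != 0.
  by move=> ll'; apply: h_neq0; apply: ltnW.
have [c c0 cE] := IHl h_neq0'; have hl0 := h_neq0 l (ltnSn l).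
have yl0 : orbit h x l ord0 != 0 by rewrite orbit0.
(* By homogeneity h(c y) = c^d h(y), while the next orbit point is h(y) multiplied by y_0 /
   h_0(y). *)
exists (c ^+ d * (tnth h ord0).@[orbit h x l] / orbit h x l ord0).
  by rewrite !mulf_neq0 ?invr_eq0 ?expf_neq0.
move=> i; rewrite /= tnth_mktuple comp_mpoly_meval (meval_scale (hh i) cE).
by field; rewrite hl0 yl0.
Qed.

Variables (x : 'I_n.+1 -> T -> k) (p : 'I_n.+1 -> k) (j : nat).
Hypothesis x_cvg : forall i, cvg openk G (x i) (p i).
Hypothesis h0_id : ratequiv h0 (idtup k n).
Hypothesis p0_neq0 : p ord0 != 0.
Hypothesis h0p_neq0 : (tnth h0 ord0).@[p] != 0.
Hypothesis j_neq0 : j%:R != 0 :> k.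
Hypothesis H_ord : G (fun t => ratequiv (tpow (H t) j) (idtup k n)).

Let y l i t := orbit (H t) (x^~ t) l i.
Let v l i t := y l.+1 i t - y l i t.
Let h i l t := (tnth (H t) i).@[y l ^~ t].
Let e i l t := (defect (H t) i).@[y l ^~ t].

Let defect0 i : defect h0 i = 0.
Proof.
by rewrite /defect; have := h0_id i ord0; rewrite !tnth_mktuple mulrC => ->; rewrite mulrC subrr.
Qed.

(** As [h0] represents the identity and its coordinate 0 does not vanish at [p], the chart map of
    [h0] fixes [p]; each step of the orbit is continuous there. *)
Lemma cvg_orbit l i : cvg openk G (y l i) (p i).
Proof.
elim: l i => [|l IHl] i; first exact: x_cvg.
have -> : p i = p ord0 * (tnth h0 i).@[p] / (tnth h0 ord0).@[p].
  apply: (canRL (mulfK h0p_neq0)).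
  have := congr1 (meval p) (defect0 i); rewrite mevalB !mevalM !mevalXU meval0.
  by move/eqP; rewrite subr_eq0 => /eqP.
apply: (cvgM topk filG); last first.
  exact: (cvgV topk filG (@cvg_eval_tup (y l) p ord0 IHl)).
exact: (cvgM topk filG (IHl ord0) (@cvg_eval_tup (y l) p i IHl)).
Qed.

Let h_cvg i l : cvg openk G (h i l) (tnth h0 i).@[p].
Proof. by apply: cvg_eval_tup => m; apply: cvg_orbit. Qed.

Let h_neq0 l : G (fun t => h ord0 l t != 0).
Proof. exact: (cvg_neq0 topk filG (@h_cvg ord0 l)). Qed.

Let defect_mcvg i : mcvg openk G (fun t => defect (H t) i) 0.
Proof.
rewrite -(defect0 i); apply: (mcvgB topk filG); apply: (mcvgM topk filG) => //;
  exact: mcvg_cst.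
Qed.

Let defect_msize i : G (fun t => msize (defect (H t) i) <= d.+2)%N.
Proof.
have X1 m : 'X_m \is [in k[n.+1], 1.-homog] by rewrite dhomogX /= mdeg1.
apply: (filterS filG) H_homog => t Ht; apply: msize_dhomog.
by apply: rpredB; apply: (dhomogM (X1 _) (Ht _)).
Qed.

Let e_cvg i l : cvg openk G (e i l) 0.
Proof.
rewrite -(meval0 p).
apply: (cvg_meval topk filG (@defect_mcvg i) (defect_msize i)) => m.
exact: cvg_orbit.
Qed.

Let vE i l t : h ord0 l t != 0 -> v l i t = e i l t / h ord0 l t.
Proof.
move=> hn0; rewrite /v /e /defect mevalB !mevalM !mevalXU /y /=.
by rewrite mulrBl mulfK.
Qed.

(** With v = e / h and primes for the index l+1, v' - v = ((e' - e) h - e (h' - h)) / (h' h). Here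
    e' - e has small coefficients because those of the defect tend to zero, and h' - h is multiplied
    by e, which tends to zero. *)
Let lspan_v l : (forall i, lspan openk G (v 0) false (v l i)) ->
  forall i, lspan openk G (v 0) true (fun t => v l.+1 i t - v l i t).
Proof.
move=> sv i.
(* The difference of these two orbit points is [v l], which lies in the span by assumption. *)
have yy m : congruent openk G (v 0) (y l.+1 m) (y l m).
  by split; [exists (p m)|exists (p m)|exact: sv]; apply: cvg_orbit.
have se : lspan openk G (v 0) true (fun t => e i l.+1 t - e i l t).
  apply: (lspan_meval topk filG _ (defect_msize i) yy) => m.
  by have := @defect_mcvg i m; rewrite mcoeff0.
have sh : lspan openk G (v 0) false (fun t => h ord0 l.+1 t - h ord0 l t).
  apply: (@lspan_meval _ _ topk _ _ filG _ _ false d.+1 _ (fun t => tnth (H t) ord0)) => //.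
    by move=> m; exists (tnth h0 ord0)@_m; apply: H_cvg.
  by apply: (filterS filG) H_homog => t Ht; apply: msize_dhomog.
have th l' : tame openk G false (h ord0 l') by exists (tnth h0 ord0).@[p].
have tV : tame openk G false (fun t => (h ord0 l.+1 t * h ord0 l t)^-1).
  exists ((tnth h0 ord0).@[p] * (tnth h0 ord0).@[p])^-1.
  by apply: (cvgV topk filG); [apply: (cvgM topk filG)|rewrite mulf_neq0].
have te : tame openk G true (e i l) by exact: e_cvg.
have := lspanMr topk filG tV (lspanB topk filG (lspanMr topk filG (th l) se)
  (lspanMl topk filG te sh)).
apply: (lspan_near filG).
apply: (filterS filG) (filterI filG (h_neq0 l.+1) (h_neq0 l)) => t [hn0 hn0'].
by rewrite !vE //; field; rewrite hn0 hn0'.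
Qed.

Let lspan_vB l i : lspan openk G (v 0) true (fun t => v l i t - v 0 i t).
Proof.
elim: l i => [|l IHl] i.
  by apply: (lspan_ext filG) (lspan0 openk filG (v 0) true) => t; rewrite subrr.
have sv m : lspan openk G (v 0) false (v l m).
  have := lspanD topk filG (lspan_conv (IHl m)) (lspan_gen openk filG (v 0) m).
  by apply: (lspan_ext filG) => t; rewrite subrK.
have := lspanD topk filG (lspan_v sv i) (IHl i).
by apply: (lspan_ext filG) => t; rewrite addrA subrK.
Qed.

(** The j-th orbit point is proportional to the starting point and has the same non-zero coordinate
    0, so the two coincide. *)
Let orbit_periodic i : G (fun t => y j i t = y 0 i t).
Proof.
have GA := filter_forall filG (fun l : 'I_j => h_neq0 l).
have Gx := cvg_neq0 topk filG (@x_cvg ord0) p0_neq0.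
have := filterI filG (filterI filG GA Gx) (filterI filG H_homog H_ord).
apply: (filterS filG) => t [[hn0 x0] [Ht Ho]].
have hn0' l : (l < j)%N -> (tnth (H t) ord0).@[orbit (H t) (x^~ t) l] != 0.
  by move=> lj; apply: (hn0 (Ordinal lj)).
have [c c0 cE] := orbit_tpow Ht x0 hn0'.
have := congr1 (meval (x^~ t)) (Ho i ord0).
rewrite !mevalM !tnth_mktuple !mevalXU !cE (orbit0 hn0') -!mulrA => /(mulfI c0).
by rewrite mulrC => /(mulfI x0).
Qed.

Lemma near_id_defect_eq0 : G (fun t => forall i, (defect (H t) i).@[x^~ t] = 0).
Proof.
suff sv i : lspan openk G (v 0) true (v 0 i).
  apply: (filterS filG) (filterI filG (h_neq0 0) (lspan_true_eq0 topk filG sv)).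
  move=> t [hn0 v0] i; have := v0 i; rewrite vE // => /eqP.
  by rewrite mulf_eq0 invr_eq0 (negPf hn0) orbF => /eqP.
(* The increments sum to y_j - y_0 = 0, so the sum of the v_l - v_0 is - j v_0; multiplying by - 1/j
   recovers v_0, to which Nakayama's lemma applies. *)
have tj : tame openk G false (fun=> - j%:R^-1) by exists (- j%:R^-1); apply: (cvg_cst filG).
have := lspanMr topk filG tj (lspan_sum topk filG (index_enum 'I_j) (fun l => lspan_vB l i)).
apply: (lspan_near filG); apply: (filterS filG) (orbit_periodic i) => t yE.
rewrite sumrB sumr_const card_ord.
have -> : \sum_(l < j) v l i t = 0.
  by rewrite -(big_mkord xpredT (fun l => v l i t)) telescope_sumr // yE subrr.
by rewrite sub0r mulrNN -[v 0 i t *+ j]mulr_natr mulfK.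
Qed.

End NearIdentity.

(** * Neighbourhood filters of tuples and of base points *)

Section TupleTopology.
Variables (k : fieldType) (openk : (k -> Prop) -> Prop) (n : nat).
Hypothesis topk : topological_field openk.
Local Notation J := ('I_n.+1 * 'X_{1..n.+1})%type.

(** Restricting to [Vd0 d] fixes the degree along the filter, which finitely many coefficient
    conditions could not do. *)
Definition nbhs_Vd0 (d : nat) (h : Tup k n) (A : Tup k n -> Prop) : Prop :=
  exists (s : seq J) (V : J -> k -> Prop),
    [/\ forall j, List.In j s -> openk (V j),
        forall j, List.In j s -> V j (coef j h) &
        forall h', Vd0 d h' -> (forall j, List.In j s -> V j (coef j h')) -> A h'].

Lemma In_mem (j : J) (s : seq J) : List.In j s <-> j \in s.
Proof.
elim: s => [|i s IHs] //=; rewrite inE; split=> [[->|/IHs ->]|/orP[/eqP->|/IHs]].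
- by rewrite eqxx.
- by rewrite orbT.
- by left.
- by right.
Qed.

Lemma nbhs_Vd0_filter d h : is_filter (nbhs_Vd0 d h).
Proof.
have [[[_ _ openI] _] _ _ _ _] := topk; split.
- by exists [::], (fun _ _ => True).
- move=> A B [s [V [oV Vh VA]]] [s' [V' [oV' Vh' VB]]].
  (* At an index in only one of the lists, the other family is unconstrained, so only the relevant
     condition is kept there. *)
  exists (s ++ s'), (fun j => if j \in s then
    if j \in s' then (fun a => V j a /\ V' j a) else V j else V' j).
  have W (Q : (k -> Prop) -> J -> Prop) j :
      (forall j, List.In j s -> Q (V j) j) -> (forall j, List.In j s' -> Q (V' j) j) ->
      (forall j, Q (V j) j -> Q (V' j) j -> Q (fun a => V j a /\ V' j a) j) ->
      List.In j (s ++ s') -> Q (if j \in s then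
        if j \in s' then (fun a => V j a /\ V' j a) else V j else V' j) j.
    move=> QV QV' QI /In_mem; rewrite mem_cat.
    case js: (j \in s); case js': (j \in s') => //= _.
    - by apply: QI; [apply: QV|apply: QV']; apply/In_mem.
    - by apply/QV/In_mem.
    - by apply/QV'/In_mem.
  split.
  + by move=> j; apply: (W (fun V _ => openk V)) => // i; apply: openI.
  + by move=> j; apply: (W (fun V j => V (coef j h))).
  + move=> h' Vd VV'; split; [apply: VA|apply: VB] => // j js.
      have := VV' j; rewrite In_mem mem_cat (iffLR (In_mem j s) js) /= => /(_ isT).
      by case: ifP => // _ [].
    have := VV' j; rewrite In_mem mem_cat (iffLR (In_mem j s') js) orbT => /(_ isT).
    by case: ifP => // _ [].
- move=> A B AB [s [V [oV Vh VA]]]; exists s, V; split=> // h' Vd Vh'.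
  exact/AB/VA.
Qed.

Lemma nbhs_Vd0_homog d h : nbhs_Vd0 d h (homtup d).
Proof. by exists [::], (fun _ _ => True); split=> // h' []. Qed.

Lemma nbhs_Vd0_mcvg d h i : mcvg openk (nbhs_Vd0 d h) (fun h' => tnth h' i) (tnth h i).
Proof.
move=> m W oW Wa; exists [:: (i, m)], (fun=> W).
by split=> // [j [<-|]|h' _ /(_ (i, m))] //; apply; left.
Qed.

(** The base point varies together with the tuple, so that a property holding along this filter
    holds on one box common to all tuples near [h]. *)
Definition nbhs_pair d h (p : 'I_n.+1 -> k) (A : Tup k n * ('I_n.+1 -> k) -> Prop) :=
  exists (B : Tup k n -> Prop) (U : 'I_n.+1 -> k -> Prop),
    [/\ nbhs_Vd0 d h B, forall i, openk (U i) /\ U i (p i) &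
        forall h' x, B h' -> (forall i, U i (x i)) -> A (h', x)].

Lemma nbhs_pair_filter d h p : is_filter (nbhs_pair d h p).
Proof.
have [[[openT _ openI] _] _ _ _ _] := topk.
have filN := nbhs_Vd0_filter d h; split.
- by exists (fun=> True), (fun _ _ => True); split=> //; apply: (filterT filN).
- move=> A A' [B [U [nB oU BA]]] [B' [U' [nB' oU' BA']]].
  exists (fun h' => B h' /\ B' h'), (fun i a => U i a /\ U' i a); split.
  + exact: (filterI filN).
  + move=> i; have [oUi Ui] := oU i; have [oUi' Ui'] := oU' i.
    by split=> //; apply: openI.
  + move=> h' x [Bh Bh'] Ux; split; [apply: BA|apply: BA'] => // i.
      by have [] := Ux i.
    by have [] := Ux i.
- by move=> A A' AA' [B [U [nB oU BA]]]; exists B, U; split=> // h' x *; apply/AA'/BA.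
Qed.

(** Relative to the tuples whose j-th iterate is the identity, so that the torsion condition holds
    along the filter. *)
Definition nbhs_torsion d h p j (A : Tup k n * ('I_n.+1 -> k) -> Prop) :=
  nbhs_pair d h p (fun t => ratequiv (tpow t.1 j) (idtup k n) -> A t).

Lemma nbhs_torsion_filter d h p j : is_filter (nbhs_torsion d h p j).
Proof.
have filN := nbhs_pair_filter d h p; split.
- exact: (filter_always filN).
- move=> A B nA nB; apply: (filterS filN) (filterI filN nA nB) => t [At Bt] jt.
  by split; auto.
- by move=> A B AB; apply: (filterS filN) => t At jt; auto.
Qed.

Lemma nbhs_torsion_Vd0 d h p j A :
  nbhs_Vd0 d h A -> nbhs_torsion d h p j (fun t => A t.1).
Proof.
have [[[openT _ _] _] _ _ _ _] := topk.
by move=> nA; exists A, (fun _ _ => True).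
Qed.

(** Along [nbhs_torsion] the defects vanish on a common open box; the sides of the box are infinite,
    so the defects are zero polynomials. *)
Lemma near_torsion_is_id d h j : non_discrete openk ->
  Vd0 d h -> ratequiv h (idtup k n) -> j%:R != 0 :> k ->
  nbhs_Vd0 d h (fun h' => ratequiv (tpow h' j) (idtup k n) -> ratequiv h' (idtup k n)).
Proof.
move=> ndk [hh hnz] hid j0; have [[[openT _ _] _] _ _ _ _] := topk.
have h0 : tnth h ord0 != 0.
  have [i hi] := hnz; apply: contraNneq (mulf_neq0 hi (mpolyX_neq0 k U_(@ord0 n))).
  by have := hid i ord0; rewrite !tnth_mktuple => -> ->; rewrite mul0r.
have [p p0] : exists p, ('X_ord0 * tnth h ord0).@[p] != 0.
  apply: NNPP => np; have /eqP := mulf_neq0 (mpolyX_neq0 k U_(@ord0 n)) h0; apply.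
  apply: (@mpoly_zero_on_box k _ (fun _ _ => True)) => [i|p _].
    exact: (open_infinite topk (p := 0)).
  by apply/eqP; apply: NNPP => pn; apply: np; exists p; apply/negP.
move: p0; rewrite mevalM mevalXU mulf_eq0 => /norP[p0 hp].
have filN := nbhs_torsion_filter d h p j.
have := @near_id_defect_eq0 k openk n topk _ _ filN d fst h _ _ (fun i t => t.2 i) p j.
case=> //.
- move=> i m W oW Wa; have nW := @nbhs_Vd0_mcvg d h i m W oW Wa.
  exact: (@nbhs_torsion_Vd0 d h p j (fun h' => W (tnth h' i)@_m) nW).
- exact: (@nbhs_torsion_Vd0 d h p j _ (nbhs_Vd0_homog d h)).
- move=> i W oW Wa; exists (fun=> True), (fun i' => if i' == i then W else (fun=> True)).
  split=> [|i'|h' x _ /(_ i)].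
  + exact: (filterT (nbhs_Vd0_filter d h)).
  + by case: eqP => [->|_].
  + by rewrite eqxx.
- by apply: (filter_always (nbhs_pair_filter d h p)).
move=> B [U [nB oU BU]]; apply: (filterS (nbhs_Vd0_filter d h)) nB => h' Bh' jh'.
have e0 i : defect h' i = 0.
  apply: (@mpoly_zero_on_box k _ U) => [i'|x Ux].
    by have [oUi Up] := oU i'; apply: (open_infinite topk ndk oUi Up).
  exact: (BU h' x Bh' Ux jh').
have E i : 'X_ord0 * tnth h' i = 'X_i * tnth h' ord0.
  by apply/eqP; rewrite -subr_eq0; apply/eqP/e0.
move=> i i'; rewrite !tnth_mktuple; apply: (mulfI (mpolyX_neq0 k U_(@ord0 n))).
by rewrite !mulrA !E; ring.
Qed.

(** Some cross product of the j-th iterate with the coordinates is non-zero at a point [z], and its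
    value at [z] depends continuously on the tuple. *)
Lemma near_not_torsion d h j : non_discrete openk ->
  ~ ratequiv (tpow h j) (idtup k n) ->
  nbhs_Vd0 d h (fun h' => ~ ratequiv (tpow h' j) (idtup k n)).
Proof.
move=> ndk hj; have [[[openT _ _] _] _ _ _ _] := topk.
have filN := nbhs_Vd0_filter d h.
pose cross (h' : Tup k n) a b : {mpoly k[n.+1]} :=
  tnth (tpow h' j) a * 'X_b - tnth (tpow h' j) b * 'X_a.
have [a [b ab]] : exists a b, cross h a b <> 0.
  apply: NNPP => nab; apply: hj => a b; rewrite !tnth_mktuple.
  apply/eqP; rewrite -subr_eq0; apply/eqP; apply: NNPP => ab.
  by apply: nab; exists a, b.
have [z /eqP zab] : exists z, (cross h a b).@[z] <> 0.
  apply: NNPP => nz; apply: ab.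
  apply: (@mpoly_zero_on_box k _ (fun _ _ => True)) => [i|z _].
    exact: (open_infinite topk (p := 0)).
  by apply: NNPP => zn; apply: nz; exists z.
have : cvg openk (nbhs_Vd0 d h) (fun h' => (cross h' a b).@[z]) (cross h a b).@[z].
  have cz i := @cvg_eval_tpow k openk n topk _ _ filN d id h (@nbhs_Vd0_mcvg d h)
    (nbhs_Vd0_homog d h) z j i.
  rewrite mevalB !mevalM.
  have -> : (fun h' => (cross h' a b).@[z]) = (fun h' =>
      (tnth (tpow h' j) a).@[z] * ('X_b).@[z] - (tnth (tpow h' j) b).@[z] * ('X_a).@[z]).
    by apply: functional_extensionality => h'; rewrite mevalB !mevalM.
  apply: (cvgB topk filN); apply: (cvgM topk filN (@cz _)); exact: (cvg_cst filN).
move/(cvg_neq0 topk filN)/(_ zab); apply: (filterS filN) => h' /eqP nz jh'; apply: nz.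
have := jh' a b; rewrite !tnth_mktuple /cross => ->.
by rewrite subrr meval0.
Qed.

End TupleTopology.

(** * Closedness of non-trivial bounded torsion, and the theorem *)

Section Torsion.
Variables (k : fieldType) (openk : (k -> Prop) -> Prop) (n D : nat).
Hypothesis topk : topological_field openk.
Hypothesis ndk : non_discrete openk.
Hypothesis pchark : [pchar k] =i pred0.

Definition nontrivial_torsion (h : Tup k n) : Prop :=
  ord_le h D /\ ~ ratequiv h (idtup k n).

(** At a representative of the identity, nearby torsion is trivial for each exponent, invertible in
    characteristic zero; elsewhere no iterate up to [D] is the identity, and this persists nearby.
    The [D] neighbourhoods are intersected. *)
Lemma near_not_nontrivial_torsion d h : Vd0 d h -> ~ nontrivial_torsion h ->
  nbhs_Vd0 openk d h (fun h' => ~ nontrivial_torsion h').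
Proof.
move=> Vh nth; have filN := nbhs_Vd0_filter topk d h.
have [hid|nhid] := classic (ratequiv h (idtup k n)).
  have near_j (j : 'I_D) : nbhs_Vd0 openk d h (fun h' =>
      ratequiv (tpow h' j.+1) (idtup k n) -> ratequiv h' (idtup k n)).
    by apply: near_torsion_is_id => //; rewrite (iffLR (pcharf0P k) pchark).
  apply: (filterS filN) (filter_forall filN near_j) => h' nh' [[[|j] [/andP[// _ jD] hj]] nid].
  exact/nid/(nh' (Ordinal jD)).
have near_j (j : 'I_D) : nbhs_Vd0 openk d h (fun h' => ~ ratequiv (tpow h' j.+1) (idtup k n)).
  apply: near_not_torsion => // hj; apply: nth; split=> //.
  by exists j.+1; rewrite /= ltn_ord.
apply: (filterS filN) (filter_forall filN near_j) => h' nh' [[[|j] [/andP[// _ jD] hj]] _].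
exact: (nh' (Ordinal jD)).
Qed.

Lemma nontrivial_torsion_saturated d : saturated d nontrivial_torsion.
Proof.
move=> h c [hh _] c0; rewrite /nontrivial_torsion ratequiv_scaleL //.
suff -> : ord_le (scale_tup c h) D <-> ord_le h D by [].
split=> -[j [jD hj]]; exists j; split=> //; have [c' c'0 E] := tpow_scale hh c0 j.
  by move: hj; rewrite E ratequiv_scaleL.
by rewrite E ratequiv_scaleL.
Qed.

Lemma nontrivial_torsion_closed d : closed_in openk (Vd0 d) nontrivial_torsion.
Proof.
(* The witness is the closure, among all tuples, of the non-trivial torsion tuples in [Vd0 d]. *)
exists (fun h => ~ nbhs_Vd0 openk d h (fun h' => ~ nontrivial_torsion h')); split.
  move=> h /NNPP [s [V [oV Vh VA]]]; exists s, V; split=> // h' Vh'; apply.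
  by exists s, V.
move=> h Vh; split=> [th [s [V [_ Vs]]] /(_ h Vh Vs)//|nn].
by apply: NNPP => nth; apply/nn/near_not_nontrivial_torsion.
Qed.

Lemma nontrivial_torsion_bir_set : bir_set nontrivial_torsion.
Proof.
have torsion_equiv h h' : is_bir h -> is_bir h' -> ratequiv h h' ->
    nontrivial_torsion h -> nontrivial_torsion h'.
  move=> bh bh' hh' [[j [jD hj]] nid]; split.
    by exists j; split=> //; apply: ratequiv_tpow_id hj.
  move=> hid; apply: nid; have [d [_ [[_ nz] _]]] := bh'.
  exact: ratequiv_trans hh' hid.
by move=> h h' bh bh' hh'; split; apply: torsion_equiv => //; apply: ratequiv_sym.
Qed.

Lemma not_nontrivial_torsion_open : bir_open openk (fun h => ~ nontrivial_torsion h).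
Proof.
split=> [h h' bh bh' hh'|d _].
  by rewrite (nontrivial_torsion_bir_set bh bh' hh').
exists nontrivial_torsion; split.
- exact: nontrivial_torsion_saturated.
- exact: nontrivial_torsion_closed.
- by move=> h _; split=> [/NNPP|th nth]; last exact: nth.
Qed.

End Torsion.

Theorem theorem1p1 (k : fieldType) (openk : (k -> Prop) -> Prop)
  (hk : local_field openk) (hchar : [pchar k] =i pred0)
  (n D : nat) (hn : (2 <= n)%N) (hD : (2 <= D)%N)
  (f : nat -> Tup k n)
  (hbir : forall m, is_bir (f m))
  (hord : exists N, forall m, (N <= m)%N -> ord_le (f m) D)
  (hcv : bir_converges openk f (idtup k n)) :
  exists N, forall m, (N <= m)%N -> ratequiv (f m) (idtup k n).
Proof.
have [topk ndk _] := hk; have [N fN] := hord.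
have [|N' fN'] := hcv _ (not_nontrivial_torsion_open n D topk ndk hchar).
  by case=> _; apply=> i j; rewrite mulrC.
exists (maxn N N') => m; rewrite geq_max => /andP[/fN om /fN' nt].
by apply: NNPP => nid; apply: nt.
Qed.
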